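(* Let $p,q>0$ and $r\ge 0$ be real numbers with $p+q+r<1$. Let $a<b$ be integers or infinite ($a\in\mathbb{Z}\cup\{-\infty\}$, $b\in\mathbb{Z}\cup\{+\infty\}$), and let $i_0$ be an integer with $a\le i_0\le b$. The solutions $(x_n)$ ($n\in\mathbb{Z}$, $a\le n\le b$) of the set of difference equations $$(1-r)x_n=\delta(n,i_0)+p\,x_{n-1}+q\,x_{n+1}\qquad (n\in\mathbb{Z},\ a<n<b)$$ are given by $$x_n=\begin{cases}\zeta\,\xi_1^{\,n-i_0}+C_1\xi_1^{\,n}+C_2\xi_2^{\,n} & (a\le n\le i_0),\\ \zeta\,\xi_2^{\,n-i_0}+C_1\xi_1^{\,n}+C_2\xi_2^{\,n} & (i_0\le n\le b),\end{cases}$$ with $C_1,C_2$ arbitrary constants, where $$\xi_1=\frac{(1-r)+\sqrt{(1-r)^2-4pq}}{2q}>1,\qquad 0<\xi_2=\frac{(1-r)-\sqrt{(1-r)^2-4pq}}{2q}<1,\qquad \zeta=\left[(1-r)^2-4pq\right]^{-1/2}.$$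
   Context: $\delta(n,i_0)$ is the Kronecker delta: $1$ if $n=i_0$ and $0$ otherwise. The numbers $p,q,r$ are probabilities. *)

(* Defs.v *)
From mathcomp Require Import all_boot all_order all_algebra.
From mathcomp Require Import reals constructive_ereal exp.

Set Implicit Arguments.
Unset Strict Implicit.
Unset Printing Implicit Defensive.

Import Order.TTheory GRing.Theory Num.Theory.

Local Open Scope ring_scope.

Section Defs.
Context {R : realType}.
Implicit Types (p q r : R) (a b : \bar int) (n : int) (x : int -> R).

Definition discr p q r : R := (1 - r) ^+ 2 - 4 * p * q.

Definition xi1 p q r : R := ((1 - r) + Num.sqrt (discr p q r)) / (2 * q).

Definition xi2 p q r : R := ((1 - r) - Num.sqrt (discr p q r)) / (2 * q).

Definition zeta p q r : R := discr p q r `^ (- (1 / 2)).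

Definition kronecker n (i0 : int) : R := if n == i0 then 1 else 0.

(* The bounds a and b live in the integers extended with -oo and +oo.  A      *)
(* family indexed by the integers n with a <= n <= b is represented by a      *)
(* function on all of int, of which only the values at such n are constrained *)
(* or described below: a < n < b puts n - 1 and n + 1 in the index range.     *)
Definition is_solution p q r a b (i0 : int) x : Prop :=
  forall n, (a < n%:E)%E -> (n%:E < b)%E ->
    (1 - r) * x n = kronecker n i0 + p * x (n - 1) + q * x (n + 1).

Definition has_closed_form p q r a b (i0 : int) (C1 C2 : R) x : Prop :=
  forall n, (a <= n%:E)%E -> (n%:E <= b)%E ->
    (n <= i0 ->
      x n = zeta p q r * xi1 p q r ^ (n - i0)
            + C1 * xi1 p q r ^ n + C2 * xi2 p q r ^ n) /\
    (i0 <= n ->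
      x n = zeta p q r * xi2 p q r ^ (n - i0)
            + C1 * xi1 p q r ^ n + C2 * xi2 p q r ^ n).

End Defs.

(* Main.v *)
Require Import Defs.
From mathcomp Require Import all_boot all_order all_algebra.
From mathcomp Require Import reals constructive_ereal exp.
From mathcomp Require Import ring lra zify.

Set Implicit Arguments.
Unset Strict Implicit.
Unset Printing Implicit Defensive.

Import Order.TTheory GRing.Theory Num.Theory.

Local Open Scope ring_scope.

(** The equations are affine in x, so their solutions are one particular
    solution plus the solutions of the homogeneous recurrence
    (1 - r) y n = p y (n - 1) + q y (n + 1).

    The numbers xi1 and xi2 are the roots of the characteristic polynomial
    f(t) = q t^2 - (1 - r) t + p, whose discriminant exceeds (p - q)^2 because
    1 - r > p + q.  As f(1) = p + q + r - 1 < 0, the point 1 lies strictly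
    between the roots, and xi2 > 0 because the product of the roots is p / q
    ([char_roots]).

    The particular solution is the Green function that follows the geometric
    sequence of xi1 up to i0 and that of xi2 afterwards; the slopes jump at i0,
    and zeta is the normalisation that makes the jump equal to the source term
    ([green_solution]).

    A solution of the homogeneous recurrence on an interval is determined by
    its values at two neighbouring points, as p and q are nonzero and the
    recurrence can be run in both directions ([homogeneous_eq0]).  The
    sequences C1 xi1^n + C2 xi2^n take any prescribed values at two neighbouring
    points because xi1 and xi2 are distinct and nonzero ([two_point_fit]).
    Since a < b, i0 has a neighbour in the index range, and fitting at this
    pair of points gives the constants. *)

(** * The characteristic roots *)

Section Roots.
Context {R : realType}.
Implicit Types p q r : R.

Lemma discr_gt0 p q r : 0 < p -> 0 < q -> p + q + r < 1 -> 0 < discr p q r.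
Proof.
move=> hp hq hpqr; rewrite /discr.
have gt_pq : 0 < (1 - r - (p + q)) * (1 - r + (p + q)) by apply: mulr_gt0; lra.
have ge0 : 0 <= (p - q) ^+ 2 by exact: sqr_ge0.
nra.
Qed.

Lemma xi_sum p q r : 0 < q -> q * (xi1 p q r + xi2 p q r) = 1 - r.
Proof. by move=> hq; rewrite /xi1 /xi2; field; rewrite gt_eqF. Qed.

Lemma xi_sub p q r : 0 < q ->
  q * (xi1 p q r - xi2 p q r) = Num.sqrt (discr p q r).
Proof. by move=> hq; rewrite /xi1 /xi2; field; rewrite gt_eqF. Qed.

Lemma xi_prod p q r : 0 < q -> 0 <= discr p q r ->
  q * (xi1 p q r * xi2 p q r) = p.
Proof.
move=> hq hd.
have -> : q * (xi1 p q r * xi2 p q r)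
        = ((1 - r) ^+ 2 - Num.sqrt (discr p q r) ^+ 2) / (4 * q).
  by rewrite /xi1 /xi2; field; rewrite gt_eqF.
by rewrite sqr_sqrtr // /discr; field; rewrite gt_eqF.
Qed.

Lemma zeta_xi_sub p q r : 0 < q -> 0 < discr p q r ->
  zeta p q r * (q * (xi1 p q r - xi2 p q r)) = 1.
Proof.
move=> hq hd; rewrite xi_sub // /zeta powRN mul1r powR12_sqrt ?ltW //.
by rewrite mulVf // gt_eqF // sqrtr_gt0.
Qed.

(** The value q (1 - xi1) (1 - xi2) of the characteristic polynomial at 1 is
    p + q + r - 1 < 0, hence 1 separates the roots. *)
Lemma char_roots p q r : 0 < p -> 0 < q -> p + q + r < 1 ->
  1 < xi1 p q r /\ 0 < xi2 p q r < 1.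
Proof.
move=> hp hq hpqr; have hd := discr_gt0 hp hq hpqr.
have hsum := xi_sum p r hq; have hprod := xi_prod hq (ltW hd).
have lt21 : xi2 p q r < xi1 p q r.
  by rewrite -subr_gt0 -(pmulr_rgt0 _ hq) xi_sub // sqrtr_gt0.
have f1 : 0 < (xi1 p q r - 1) * (1 - xi2 p q r).
  rewrite -(pmulr_rgt0 _ hq).
  have -> : q * ((xi1 p q r - 1) * (1 - xi2 p q r))
          = q * (xi1 p q r + xi2 p q r) - q - q * (xi1 p q r * xi2 p q r).
    by ring.
  by rewrite hsum hprod; lra.
have gt1 : 1 < xi1 p q r.
  rewrite ltNge; apply/negP => le1.
  have : 0 <= (1 - xi1 p q r) * (1 - xi2 p q r) by apply: mulr_ge0; lra.
  lra.
split=> //; apply/andP; split.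
  by rewrite -(pmulr_rgt0 _ (lt_trans ltr01 gt1)) -(pmulr_rgt0 _ hq) hprod.
by rewrite pmulr_rgt0 subr_gt0 in f1.
Qed.

End Roots.

(** * Neighbours in an interval of integers *)

Lemma succ_leeE (n : int) (b : \bar int) :
  ((n + 1)%:E <= b)%E = (n%:E < b)%E.
Proof.
by case: b => [b||]; rewrite ?lee_fin ?lte_fin ?leey ?ltry //; lia.
Qed.

Lemma lee_predE (n : int) (a : \bar int) :
  (a <= (n - 1)%:E)%E = (a < n%:E)%E.
Proof.
by case: a => [a||]; rewrite ?lee_fin ?lte_fin ?leNye ?ltNyr //; lia.
Qed.

(** * The homogeneous recurrence on an interval of integers *)

Section Homogeneous.
Context {F : fieldType}.
Implicit Types (c p q s t : F) (a b : \bar int) (m n : int) (y : int -> F).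

Definition homogeneous c p q a b y : Prop :=
  forall n, (a < n%:E)%E -> (n%:E < b)%E ->
    c * y n = p * y (n - 1) + q * y (n + 1).

Lemma expz_succ t n : t != 0 -> t ^ (n + 1) = t * t ^ n.
Proof. by move=> t0; rewrite expfzDr // expr1z mulrC. Qed.

Lemma expz_pred t n : t != 0 -> t ^ (n - 1) = t^-1 * t ^ n.
Proof. by move=> t0; rewrite expfzDr // mulrC. Qed.

Lemma vieta_root c p q s t : q * (s + t) = c -> q * (s * t) = p ->
  c * s = p + q * s ^+ 2.
Proof. by move=> <- <-; ring. Qed.

Lemma geometric_homogeneous c p q t a b : t != 0 -> c * t = p + q * t ^+ 2 ->
  homogeneous c p q a b (fun n => t ^ n).
Proof.
move=> t0 ht n _ _; rewrite expz_succ // expz_pred //.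
have -> : c = (p + q * t ^+ 2) / t by rewrite -ht mulfK.
by field.
Qed.

Lemma homogeneous_lin c p q a b (C D : F) y z :
  homogeneous c p q a b y -> homogeneous c p q a b z ->
  homogeneous c p q a b (fun n => C * y n + D * z n).
Proof.
move=> hy hz n an nb; move: (hy n an nb) (hz n an nb) => ey ez.
by rewrite mulrDr !(mulrCA c) ey ez; ring.
Qed.

(** The vanishing spreads from the pair {m, m + 1}: upwards because the
    equation at n gives y (n + 1) from y (n - 1) and y n, downwards because it
    gives y (n - 1) from y n and y (n + 1). *)
Lemma homogeneous_eq0 c p q a b m y : p != 0 -> q != 0 ->
  (a <= m%:E)%E -> ((m + 1)%:E <= b)%E ->
  homogeneous c p q a b y -> y m = 0 -> y (m + 1) = 0 ->
  forall n, (a <= n%:E)%E -> (n%:E <= b)%E -> y n = 0.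
Proof.
move=> p0 q0 am mb hy y0 y1.
have up (k : nat) : ((m + k%:Z + 1)%:E <= b)%E ->
    y (m + k%:Z) = 0 /\ y (m + k%:Z + 1) = 0.
  elim: k => [|k IH] kb; first by rewrite addr0.
  have kb' : ((m + k%:Z + 1)%:E < b)%E.
    by apply: lt_le_trans kb; rewrite lte_fin; lia.
  have [yk yk1] := IH (ltW kb').
  have -> : m + k.+1%:Z = m + k%:Z + 1 by lia.
  split=> //; have := hy _ _ kb'.
  rewrite addrK yk yk1 !mulr0 add0r => /(_ _)/esym/eqP.
  rewrite mulf_eq0 (negPf q0) => h; apply/eqP/h.
  by apply: le_lt_trans am _; rewrite lte_fin; lia.
have down (k : nat) : (a <= (m - k%:Z)%:E)%E ->
    y (m - k%:Z) = 0 /\ y (m - k%:Z + 1) = 0.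
  elim: k => [|k IH] ak; first by rewrite subr0.
  have ak' : (a < (m - k%:Z)%:E)%E.
    by apply: le_lt_trans ak _; rewrite lte_fin; lia.
  have [yk yk1] := IH (ltW ak').
  have e : m - k.+1%:Z = m - k%:Z - 1 by lia.
  rewrite e subrK; split=> //; have := hy _ ak'.
  rewrite yk yk1 !mulr0 addr0 => /(_ _)/esym/eqP.
  rewrite mulf_eq0 (negPf p0) => h; apply/eqP/h.
  by apply: lt_le_trans mb; rewrite lte_fin; lia.
move=> n an nb; have [nm|mn] := leP n m.
  have e : n = m - `|(m - n)%R|%N%:Z by lia.
  by rewrite e; apply: (proj1 (down _ _)); rewrite -e.
have e : n = m + `|(n - m - 1)%R|%N%:Z + 1 by lia.
by rewrite e; apply: (proj2 (up _ _)); rewrite -e.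
Qed.

(** The system for the constants has determinant s^m t^m (t - s). *)
Lemma two_point_fit (s t u v : F) m : s != 0 -> t != 0 -> s != t ->
  exists C1 C2 : F, C1 * s ^ m + C2 * t ^ m = u /\
                    C1 * s ^ (m + 1) + C2 * t ^ (m + 1) = v.
Proof.
move=> s0 t0 st; rewrite !expz_succ //.
have sm0 : s ^ m != 0 by exact: expfz_neq0.
have tm0 : t ^ m != 0 by exact: expfz_neq0.
have d0 : s - t != 0 by rewrite subr_eq0.
exists ((v - t * u) / (s - t) / s ^ m), ((s * u - v) / (s - t) / t ^ m).
by split; field; rewrite d0 sm0 tm0.
Qed.

End Homogeneous.

(** * The particular solution *)

Section Green.
Context {R : realType}.
Implicit Types (p q r s t z : R) (n : int).

Definition green z s t (i0 : int) n : R := z * (if n <= i0 then s else t) ^ (n - i0).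

(** By the product and sum relations s and t are the roots of the
    characteristic polynomial.  For n other than i0 the three values involved
    lie on one geometric sequence with ratio s or t, so the source-free equation
    holds.  At n = i0 the defect is z (q (s + t) - p / s - q t) = z q (s - t),
    since p / s = q t. *)
Lemma green_solution c p q s t z (i0 : int) n : s != 0 -> t != 0 ->
  q * (s + t) = c -> q * (s * t) = p -> z * (q * (s - t)) = 1 ->
  c * green z s t i0 n =
    kronecker n i0 + p * green z s t i0 (n - 1) + q * green z s t i0 (n + 1).
Proof.
move=> s0 t0 <- <- hz; rewrite /green /kronecker.
rewrite [n - 1 - i0]addrAC [n + 1 - i0]addrAC.
have [ni|ni|->] := ltgtP n i0.
- rewrite ifT; last by lia.
  rewrite ifT; last by lia.
  by rewrite expz_succ // expz_pred //; field.
- (* The branch used at n - 1 is that of s exactly when n - 1 = i0, where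
     both branches equal z. *)
  have [e|ne] := eqVneq n (i0 + 1).
    rewrite e addrK lexx ifF; last by lia.
    have -> : i0 + 1 - i0 = 1 by lia.
    rewrite expz_succ // subrr expr0z expr1z.
    by ring.
  rewrite ifF; last by lia.
  rewrite ifF; last by lia.
  by rewrite expz_succ // expz_pred //; field.
- rewrite subrr ifT; last by lia.
  rewrite ifF; last by lia.
  rewrite expz_succ // expz_pred // expr0z !mulr1 -hz.
  by field.
Qed.

(** The two descriptions of the closed form overlap at i0, where both powers
    have exponent 0. *)
Lemma has_closed_formE p q r a b (i0 : int) (C1 C2 : R) (x : int -> R) :
  has_closed_form p q r a b i0 C1 C2 x <->
  forall n, (a <= n%:E)%E -> (n%:E <= b)%E ->
    x n = green (zeta p q r) (xi1 p q r) (xi2 p q r) i0 n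
          + (C1 * xi1 p q r ^ n + C2 * xi2 p q r ^ n).
Proof.
rewrite /green; split=> h n an nb; have := h n an nb.
  by case: leP => [ni [-> //]|/ltW ni [_ ->] //]; rewrite addrA.
case: (ltgtP n i0) => [ni|ni|->] ->; rewrite ?subrr ?expr0z addrA; split=> //.
Qed.

End Green.

(** * The general solution *)

Theorem theorem1 (R : realType) (p q r : R)
  (hp : 0 < p) (hq : 0 < q) (hr : 0 <= r) (hpqr : p + q + r < 1)
  (a b : \bar int) (ha : a <> +oo%E) (hb : b <> -oo%E) (hab : (a < b)%E)
  (i0 : int) (hai0 : (a <= i0%:E)%E) (hi0b : (i0%:E <= b)%E) :
  [/\ 1 < xi1 p q r,
      0 < xi2 p q r < 1 &
      forall x : int -> R,
        is_solution p q r a b i0 x <->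
        exists C1 C2 : R, has_closed_form p q r a b i0 C1 C2 x].
Proof.
have [gt1 xi2P] := char_roots hp hq hpqr; split=> // x.
have hd := discr_gt0 hp hq hpqr.
have hsum := xi_sum p r hq; have hprod := xi_prod hq (ltW hd).
have hz := zeta_xi_sub hq hd.
have s0 : xi1 p q r != 0 by rewrite gt_eqF // (lt_trans ltr01).
have t0 : xi2 p q r != 0 by rewrite gt_eqF //; case/andP: xi2P.
have st : xi1 p q r != xi2 p q r.
  by rewrite gt_eqF // (lt_trans _ gt1) //; case/andP: xi2P.
pose G := green (zeta p q r) (xi1 p q r) (xi2 p q r) i0.
pose H C1 C2 n : R := C1 * xi1 p q r ^ n + C2 * xi2 p q r ^ n.
have GE n : (1 - r) * G n =
    kronecker n i0 + p * G (n - 1) + q * G (n + 1).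
  exact: green_solution.
have HE C1 C2 : homogeneous (1 - r) p q a b (H C1 C2).
  apply: homogeneous_lin; apply: geometric_homogeneous => //.
    exact: vieta_root hsum hprod.
  apply: (@vieta_root _ _ _ _ _ (xi1 p q r)).
    by rewrite [xi2 _ _ _ + _]addrC.
  by rewrite [xi2 _ _ _ * _]mulrC.
split=> [sol|[C1 [C2 /has_closed_formE xE]] n an nb]; last first.
  have [an1 nb1] : (a <= (n - 1)%:E)%E /\ ((n + 1)%:E <= b)%E.
    by rewrite lee_predE succ_leeE.
  have an2 : (a <= (n + 1)%:E)%E.
    by apply: le_trans (ltW an) _; rewrite lee_fin lerDl.
  have nb2 : ((n - 1)%:E <= b)%E.
    by apply: le_trans _ (ltW nb); rewrite lee_fin gerBl.
  rewrite !xE ?(ltW an) ?(ltW nb) // -!/(G _) -!/(H C1 C2 _) mulrDr GE HE //.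
  by ring.
(* A neighbouring pair in the range: {i0, i0 + 1}, or {i0 - 1, i0} if i0 = b. *)
have [m [am mb]] : exists m : int, (a <= m%:E)%E /\ ((m + 1)%:E <= b)%E.
  have [ib|bi] := ltP i0%:E b; first by exists i0; rewrite succ_leeE.
  exists (i0 - 1); rewrite lee_predE subrK; split=> //.
  exact: lt_le_trans hab bi.
have [C1 [C2 [Hm Hm1]]] :=
  two_point_fit (x m - G m) (x (m + 1) - G (m + 1)) m s0 t0 st.
exists C1, C2; apply/has_closed_formE => n an nb.
rewrite -/(G n) -/(H C1 C2 n).
have hy : homogeneous (1 - r) p q a b (fun k => x k - G k - H C1 C2 k).
  move=> k ak kb; rewrite !mulrBr sol // GE HE //.
  by ring.
have := homogeneous_eq0 (lt0r_neq0 hp) (lt0r_neq0 hq) am mb hy.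
rewrite /H Hm Hm1 !subrr => /(_ erefl erefl n an nb)/eqP.
by rewrite -addrA -opprD subr_eq0 => /eqP.
Qed.
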